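(* Let $(N,\mu,\nu)$ be an intuitionistic fuzzy normed space, let $(u_k)_{k\ge 1}$ be a sequence in $N$ and let $a\in N$. If $(u_k)$ is statistically Cesàro summable to $a$ and slowly oscillating, then $(u_k)$ is convergent to $a$ in $(N,\mu,\nu)$.
   Context: An intuitionistic fuzzy normed space (IFNS) is a triple $(N,\mu,\nu)$ where $N$ is a real vector space with zero vector $\theta$ and $\mu,\nu:N\times\mathbb{R}\to[0,1]$ satisfy, for all $u,w\in N$ and $t,s\in\mathbb{R}$: (a) $\mu(u,t)=0$ for $t\le 0$; (b) $\mu(u,t)=1$ for all $t>0$ if and only if $u=\theta$; (c) $\mu(cu,t)=\mu(u,t/|c|)$ for all $t>0$ and real $c\ne 0$; (d) $\mu(u+w,t+s)\ge\min\{\mu(u,t),\mu(w,s)\}$; (e) $\lim_{t\to\infty}\mu(u,t)=1$, and $\lim_{t\to 0}\mu(u,t)=0$ if $u\neq\theta$; (f) $\nu(u,t)=1$ for $t\le 0$; (g) $\nu(u,t)=0$ for all $t>0$ if and only if $u=\theta$; (h) $\nu(cu,t)=\nu(u,t/|c|)$ for all $t>0$ and real $c\neq 0$; (i) $\max\{\nu(u,t),\nu(w,s)\}\ge\nu(u+w,t+s)$; (j) $\lim_{t\to\infty}\nu(u,t)=0$, and $\lim_{t\to0}\nu(u,t)=1$ if $u\ne\theta$. A sequence $(u_k)$ in $N$ is convergent to $a\in N$ if for every $\varepsilon>0$ and $t>0$ there is $k_0\in\mathbb{N}$ such that $\mu(u_k-a,t)>1-\varepsilon$ and $\nu(u_k-a,t)<\varepsilon$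 for all $k\ge k_0$. A sequence $(v_k)$ in $N$ is statistically convergent to $a\in N$ with respect to $(\mu,\nu)$ if for every $\varepsilon>0$ and $t>0$, $\lim_{n\to\infty}\frac1n\left|\{k\le n:\mu(v_k-a,t)\le 1-\varepsilon\text{ or }\nu(v_k-a,t)\ge\varepsilon\}\right|=0$. $(u_k)$ is statistically Cesàro summable to $a$ if the sequence $(\sigma_k)$ of Cesàro means $\sigma_k=\frac1k\sum_{j=1}^k u_j$ is statistically convergent to $a$. $(u_k)$ is slowly oscillating if for all $t>0$ and all $\varepsilon\in(0,1)$ there exist $\lambda>1$ and $m_0\in\mathbb{N}$ (depending on $t$ and $\varepsilon$) such that $\mu(u_k-u_n,t)>1-\varepsilon$ and $\nu(u_k-u_n,t)<\varepsilon$ whenever $m_0\le n<k\le\lfloor\lambda n\rfloor$. *)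

(* Defs.v *)
From HB Require Import structures.
From mathcomp Require Import all_boot all_order all_algebra.
From mathcomp Require Import all_classical all_reals all_analysis.

Set Implicit Arguments.
Unset Strict Implicit.
Unset Printing Implicit Defensive.

Import Order.TTheory GRing.Theory Num.Theory numFieldNormedType.Exports.

Local Open Scope classical_set_scope.
Local Open Scope ring_scope.

(* A sequence (u_k)_{k >= 1} is a function u : nat -> N whose value at 0 is
   never used. *)

(* 0^' is the two-sided punctured neighbourhood filter of 0. *)
Record is_ifns (R : realType) (N : lmodType R) (mu nu : N -> R -> R) : Prop :=
  IsIFNS {
    ifns_mu_range : forall (u : N) (t : R), 0 <= mu u t <= 1 ;
    ifns_nu_range : forall (u : N) (t : R), 0 <= nu u t <= 1 ;
    ifns_mu_le0 : forall (u : N) (t : R), t <= 0 -> mu u t = 0 ;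
    ifns_mu_eq1 : forall u : N, (forall t : R, 0 < t -> mu u t = 1) <-> u = 0 ;
    ifns_mu_scale : forall (u : N) (c t : R), 0 < t -> c != 0 ->
      mu (c *: u) t = mu u (t / `|c|) ;
    ifns_mu_add : forall (u w : N) (t s : R),
      Num.min (mu u t) (mu w s) <= mu (u + w) (t + s) ;
    ifns_mu_pinfty : forall u : N, mu u t @[t --> +oo] --> (1 : R) ;
    ifns_mu_at0 : forall u : N, u != 0 -> mu u t @[t --> (0 : R)^'] --> (0 : R) ;
    ifns_nu_le0 : forall (u : N) (t : R), t <= 0 -> nu u t = 1 ;
    ifns_nu_eq0 : forall u : N, (forall t : R, 0 < t -> nu u t = 0) <-> u = 0 ;
    ifns_nu_scale : forall (u : N) (c t : R), 0 < t -> c != 0 ->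
      nu (c *: u) t = nu u (t / `|c|) ;
    ifns_nu_add : forall (u w : N) (t s : R),
      nu (u + w) (t + s) <= Num.max (nu u t) (nu w s) ;
    ifns_nu_pinfty : forall u : N, nu u t @[t --> +oo] --> (0 : R) ;
    ifns_nu_at0 : forall u : N, u != 0 -> nu u t @[t --> (0 : R)^'] --> (1 : R)
  }.

Definition ifns_cvg (R : realType) (N : lmodType R) (mu nu : N -> R -> R)
    (u : nat -> N) (a : N) : Prop :=
  forall eps t : R, 0 < eps -> 0 < t ->
  exists k0 : nat, forall k : nat, (0 < k)%N -> (k0 <= k)%N ->
    mu (u k - a) t > 1 - eps /\ nu (u k - a) t < eps.

(* index_iota 1 n.+1 is the list 1, ..., n. *)
Definition ifns_stat_cvg (R : realType) (N : lmodType R) (mu nu : N -> R -> R)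
    (v : nat -> N) (a : N) : Prop :=
  forall eps t : R, 0 < eps -> 0 < t ->
  (count (fun k => (mu (v k - a) t <= 1 - eps) || (nu (v k - a) t >= eps))
     (index_iota 1 n.+1))%:R / n%:R @[n --> \oo] --> (0 : R).

Definition cesaro_mean (R : realType) (N : lmodType R) (u : nat -> N)
    (k : nat) : N :=
  (k%:R^-1 : R) *: \sum_(1 <= j < k.+1) u j.

Definition ifns_stat_cesaro_summable (R : realType) (N : lmodType R)
    (mu nu : N -> R -> R) (u : nat -> N) (a : N) : Prop :=
  ifns_stat_cvg mu nu (cesaro_mean u) a.

(* For n = 0 the range of k is empty, so u 0 plays no role. *)
Definition ifns_slowly_oscillating (R : realType) (N : lmodType R)
    (mu nu : N -> R -> R) (u : nat -> N) : Prop :=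
  forall t eps : R, 0 < t -> 0 < eps < 1 ->
  exists (lambda : R) (m0 : nat), 1 < lambda /\
    forall n k : nat, (m0 <= n)%N -> (n < k)%N ->
      k%:Z <= Num.floor (lambda * n%:R) ->
      mu (u k - u n) t > 1 - eps /\ nu (u k - u n) t < eps.

(* Main.v *)
Require Import Defs.
From mathcomp Require Import all_boot all_order all_algebra.
From mathcomp Require Import all_classical all_reals all_analysis.
From mathcomp Require Import zify ring lra.

(** For fixed [eps] in (0,1) the set of pairs [(w, t)] with [mu w t > 1 - eps]
    and [nu w t < eps] behaves like the set [p w < t] for a seminorm [p], so
    the statement reduces to a Tauberian theorem for one seminorm.  A set of
    density zero misses points of every interval (l, l + d] with l large and d
    at least a fixed fraction of l.  Hence, for n large, there are m and m'
    with n < m < m' <= lambda n, with m' - m of order n, at which the Cesaro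
    means [sigma] are close to [a].  Then
    [(m' - m)(u_n - a) = sum_(m < j <= m') (u_n - u_j)
                         + m'(sigma_m' - a) - m(sigma_m - a)],
    where slow oscillation controls the first sum. *)

Import Order.TTheory GRing.Theory Num.Theory numFieldNormedType.Exports.
Local Open Scope classical_set_scope.
Local Open Scope ring_scope.

(** If [P] held on all of (l, l + d], its frequency up to l + d would be at least d / (l + d) >= 1 /
    (q + 1), above the bound 1 / (q + 2) that holds for large indices. *)
Lemma density0_gap {R : realType} {P : pred nat} :
  (count P (index_iota 1 n.+1))%:R / n%:R @[n --> \oo] --> (0 : R) ->
  forall q : nat, exists n0 : nat, forall l d : nat, (n0 <= l)%N -> (0 < d)%N ->
    (l <= q * d)%N -> exists m : nat, (l < m <= l + d)%N && ~~ P m.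
Proof.
move=> /cvgrPdist_lt cvgP q.
have q2 : (0 : R) < (q.+2)%:R by rewrite ltr0n.
have [n0 _ n0P] : \forall n \near \oo,
    `|0 - (count P (index_iota 1 n.+1))%:R / n%:R| < (q.+2)%:R^-1 :> R.
  by apply: cvgP; rewrite invr_gt0.
exists n0 => l d n0l d0 lqd; apply: contrapT => allbad.
have cntP : count P (index_iota l.+1 (l + d).+1) = d.
  have -> : count P (index_iota l.+1 (l + d).+1)
            = size (index_iota l.+1 (l + d).+1).
    apply/eqP; rewrite -all_count; apply/allP => m; rewrite mem_index_iota => lm.
    by apply: contrapT => /negP Pm; apply: allbad; exists m; rewrite Pm andbT; lia.
  by rewrite size_iota; lia.
have le_cnt : (d <= count P (index_iota 1 (l + d).+1))%N.
  have -> : index_iota 1 (l + d).+1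
            = index_iota 1 l.+1 ++ index_iota l.+1 (l + d).+1.
    rewrite /index_iota !subn1 /= subSS addKn iotaD add1n.
    by [].
  by rewrite count_cat cntP leq_addl.
have ld0 : (0 : R) < (l + d)%:R by rewrite ltr0n; lia.
have : `|0 - (count P (index_iota 1 (l + d).+1))%:R / (l + d)%:R|
       < (q.+2)%:R^-1 :> R by apply: n0P => /=; lia.
rewrite sub0r normrN ger0_norm; last by rewrite divr_ge0.
rewrite ltr_pdivrMr // mulrC ltr_pdivlMr // -natrM ltr_nat.
nia.
Qed.

(* [B w t] reads [p w < t]. *)
Definition seminorm_like {R : realType} {N : lmodType R}
    (B : N -> R -> bool) : Prop :=
  [/\ forall w v t s, B w t -> B v s -> B (w + v) (t + s),
      forall (c : R) w t, c != 0 -> 0 < t -> B w t -> B (c *: w) (`|c| * t) &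
      forall w t s, t <= s -> B w t -> B w s].

(** The sum has [d.+1] terms because an empty one would require [B 0 0], read as p 0 < 0. *)
Lemma seminorm_like_sum {R : realType} {N : lmodType R} {B : N -> R -> bool}
    (f : nat -> N) (r : R) (m d : nat) :
  seminorm_like B ->
  (forall j, (m < j <= m + d.+1)%N -> B (f j) r) ->
  B (\sum_(m.+1 <= j < (m + d.+1).+1) f j) (d.+1%:R * r).
Proof.
move=> [addB _ _]; elim: d => [|d IHd] Bf.
  by rewrite addn1 big_nat1 mul1r; apply: Bf; lia.
rewrite addnS big_nat_recr /=; last by lia.
rewrite -[d.+2]addn1 natrD mulrDl mul1r; apply: addB.
  by apply: IHd => j lej; apply: Bf; lia.
by apply: Bf; lia.
Qed.

(** The difference of k times the k-th mean and m times the m-th mean is the sum of the [u j] with m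
    < j <= k, which cancels the [u j] of the first sum. *)
Lemma cesaro_block {R : realType} {N : lmodType R} (u : nat -> N) (a w : N)
    (m k : nat) : (0 < m)%N -> (m <= k)%N ->
  (k - m)%:R *: (w - a) = \sum_(m.+1 <= j < k.+1) (w - u j)
    + (k%:R *: (cesaro_mean u k - a) - m%:R *: (cesaro_mean u m - a)) :> N.
Proof.
move=> m0 mk.
have mean n : (0 < n)%N ->
    n%:R *: (cesaro_mean u n - a) = \sum_(1 <= j < n.+1) u j - n%:R *: a.
  by move=> n0; rewrite scalerBr scalerA divff ?scale1r // pnatr_eq0 -lt0n.
rewrite !mean //; last by lia.
rewrite [\sum_(1 <= j < k.+1) _](big_cat_nat (n := m.+1)) //=.
rewrite sumrB sumr_const_nat subSS scalerBr scaler_nat natrB // scalerBl.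
set S1 := \sum_(1 <= i < _) _; set S2 := \sum_(m.+1 <= i < _) _.
have -> : S1 + S2 - k%:R *: a - (S1 - m%:R *: a)
          = S2 - (k%:R *: a - m%:R *: a).
  by rewrite -[LHS]addrA -opprD addrCA opprD addrA [S1 + S2]addrC addrK.
by rewrite addrA subrK.
Qed.

Lemma seminorm_like_tauberian {R : realType} {N : lmodType R}
    {B : N -> R -> bool} (u : nat -> N) (a : N) :
  seminorm_like B ->
  (forall t : R, 0 < t ->
    (count (fun k => ~~ B (cesaro_mean u k - a) t) (index_iota 1 n.+1))%:R
      / n%:R @[n --> \oo] --> (0 : R)) ->
  (forall t : R, 0 < t -> exists (lambda : R) (m0 : nat), 1 < lambda /\
    forall n k : nat, (m0 <= n)%N -> (n < k)%N ->
      k%:Z <= Num.floor (lambda * n%:R) -> B (u k - u n) t) ->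
  forall t : R, 0 < t -> exists k0 : nat, forall k : nat, (k0 <= k)%N ->
    B (u k - a) t.
Proof.
move=> semiB statB oscB t t0; have [addB scaleB monoB] := semiB.
have oppB v r : 0 < r -> B v r -> B (- v) r.
  move=> r0 Bv; have := scaleB (-1) v r; rewrite scaleN1r normrN1 mul1r.
  by apply; rewrite // oppr_eq0 oner_eq0.
have t20 : 0 < t / 2 by rewrite divr_gt0.
have [lambda [m0 [lambda1 oscm0]]] := oscB _ t20.
have [q q0 q_lambda] : exists2 q : nat, (0 < q)%N & 3 <= (lambda - 1) * q%:R.
  exists (Num.truncn (3 / (lambda - 1))).+1 => //.
  rewrite mulrC -ler_pdivrMr ?subr_gt0 //; apply/ltW.
  exact: truncnS_gt.
(* Chosen so that k + m <= 4 (q + 1) (k - m) gives (k + m) s <= (k - m) t / 2, the half of the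
   tolerance left for the two means. *)
pose s : R := t / (8 * q%:R + 8).
have q8 : (0 : R) < 8 * q%:R + 8 by rewrite ltr_wpDl.
have s0 : 0 < s by rewrite divr_gt0.
(* The gap is used with l = n and l = n + 2d; as n <= 2qd, both are at most (2q + 2) d. *)
have [n0 gap] := density0_gap (statB s s0) (2 * q + 2)%N.
exists (maxn q (maxn n0 m0)) => n; rewrite !geq_max => /and3P[qn n0n m0n].
(* [3 <= (lambda - 1) q] gives [n + 3 d <= lambda n]; [m] is taken in
   (n, n + d] and [k] in (n + 2d, n + 3d]. *)
pose d := (n %/ q)%N.
have d0 : (0 < d)%N by rewrite divn_gt0.
have dqn : (d * q <= n)%N by apply: leq_trunc_div.
have n2qd : (n <= 2 * q * d)%N.
  have := ltn_ceil n q0; rewrite -/d; nia.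
have [m /andP[nm /negPn Bm]] : exists m, (n < m <= n + d)%N &&
    ~~ ~~ B (cesaro_mean u m - a) s by apply: gap => //; nia.
have [k /andP[nk /negPn Bk]] : exists k, (n + 2 * d < k <= n + 2 * d + d)%N &&
    ~~ ~~ B (cesaro_mean u k - a) s by apply: gap => //; nia.
have mltk : (m < k)%N by lia.
have oscn j : (m < j <= k)%N -> B (u n - u j) (t / 2).
  move=> mjk; rewrite -opprB; apply: oppB => //; apply: oscm0 => //; first by lia.
  rewrite floor_ge_int.
  have jn3d : (j <= n + 3 * d)%N by lia.
  have jR : (j%:R : R) <= n%:R + 3 * d%:R by rewrite -natrM -natrD ler_nat.
  have dR : (d%:R : R) * q%:R <= n%:R by rewrite -natrM ler_nat.
  have dn0 : (0 : R) <= d%:R by [].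
  rewrite -pmulrn; nra.
have kmE : (k - m)%N = (k - m).-1.+1 by lia.
have km0 : (0 : R) < (k - m)%:R by rewrite ltr0n subn_gt0.
have Bsum : B (\sum_(m.+1 <= j < k.+1) (u n - u j)) ((k - m)%:R * (t / 2)).
  have := seminorm_like_sum (fun j => u n - u j) (t / 2) m (k - m).-1 semiB.
  rewrite -kmE subnKC; last exact: ltnW.
  exact.
have Bmean j : (0 < j)%N -> forall v, B v s -> B (j%:R *: v) (j%:R * s).
  move=> j0 v Bv; rewrite -[X in X * s](@ger0_norm R) //.
  by apply: scaleB => //; rewrite pnatr_eq0 -lt0n.
(* Skipping (n + d, n + 2d] ensures k - m > d, while k + m <= 2n + 4d <= 4 (q + 1) d. *)
have mk_le : ((k + m)%:R * s : R) <= (k - m)%:R * (t / 2).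
  have : (k + m <= 4 * q.+1 * (k - m))%N by nia.
  rewrite -(ler_nat R) 2!natrM -[q.+1%:R]natr1 /s => le4.
  rewrite mulrA ler_pdivrMr //; nra.
have Bkm : B ((k - m)%:R *: (u n - a)) ((k - m)%:R * t).
  rewrite (cesaro_block u); [|lia|exact: ltnW].
  apply: (monoB _ ((k - m)%:R * (t / 2) + (k%:R * s + m%:R * s))).
    by rewrite -mulrDl -natrD; nra.
  apply: (addB) => //; apply: addB; first by apply: Bmean => //; lia.
  by apply: oppB; [rewrite mulr_gt0 // ltr0n; lia|apply: Bmean => //; lia].
have := scaleB ((k - m)%:R^-1) _ _ (invr_neq0 (lt0r_neq0 km0))
  (mulr_gt0 km0 t0) Bkm.
rewrite scalerA ger0_norm ?invr_ge0 ?(ltW km0) // mulrA.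
by rewrite mulVf ?scale1r ?mul1r // lt0r_neq0.
Qed.

Definition ifns_ball {R : realType} {N : lmodType R} (mu nu : N -> R -> R)
    (eps : R) (w : N) (t : R) : bool :=
  (1 - eps < mu w t) && (nu w t < eps).

(** The min and max in the triangle inequalities leave [eps] unchanged under addition, so that only
    the radii add up. *)
Lemma ifns_ball_seminorm_like {R : realType} {N : lmodType R}
    {mu nu : N -> R -> R} (eps : R) :
  is_ifns mu nu -> 0 < eps -> seminorm_like (ifns_ball mu nu eps).
Proof.
move=> hN eps0.
have addB w v t s : ifns_ball mu nu eps w t -> ifns_ball mu nu eps v s ->
    ifns_ball mu nu eps (w + v) (t + s).
  move=> /andP[muw nuw] /andP[muv nuv]; apply/andP; split.
    by apply: lt_le_trans (ifns_mu_add hN w v t s); rewrite lt_min muw.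
  by apply: le_lt_trans (ifns_nu_add hN w v t s) _; rewrite gt_max nuw.
split=> // [c w t c0 t0|w t s].
  have c_gt0 : 0 < `|c| by rewrite normr_gt0.
  rewrite /ifns_ball (ifns_mu_scale hN) ?(ifns_nu_scale hN) ?mulr_gt0 //.
  by rewrite mulrAC divff ?mul1r ?gt_eqF.
rewrite le_eqVlt => /predU1P[->//|ts] Bwt.
(* Monotonicity in the radius comes from w = w + 0, since 0 lies in the ball of radius s - t > 0. *)
rewrite -[w]addr0 -(subrK t s) [s - t + t]addrC; apply: addB => //.
rewrite /ifns_ball (ifns_mu_eq1 hN 0).2 ?(ifns_nu_eq0 hN 0).2 ?subr_gt0 //.
by rewrite eps0 andbT; lra.
Qed.

Theorem theorem2p6 (R : realType) (N : lmodType R) (mu nu : N -> R -> R)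
    (hN : is_ifns mu nu) (u : nat -> N) (a : N)
    (hsum : ifns_stat_cesaro_summable mu nu u a)
    (hosc : ifns_slowly_oscillating mu nu u) :
  ifns_cvg mu nu u a.
Proof.
move=> eps t eps0 t0.
(* Slow oscillation is available only below 1, whereas [eps] is any positive number; the conclusion
   for the smaller [e] implies the one for [eps]. *)
pose e := Num.min eps (1 / 2).
have e0 : 0 < e by rewrite lt_min eps0 divr_gt0.
have e1 : e < 1 by rewrite gt_min; apply/orP; right; lra.
have e_eps : e <= eps by rewrite ge_min lexx.
have [] := seminorm_like_tauberian u a (ifns_ball_seminorm_like e hN e0)
  _ _ t t0.
- move=> s s0; have := hsum e s e0 s0.
  (* By De Morgan, the exceptional indices are those outside the ball. *)
  under eq_fun do under eq_count do rewrite !leNgt -negb_and.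
  exact.
- move=> s s0; have [|lambda [m0 [lambda1 hm0]]] := hosc s e s0; first by rewrite e0.
  exists lambda, m0; split=> // n k m0n nk kn.
  by apply/andP; apply: hm0.
move=> k0 hk0; exists k0 => k _ /hk0 /andP[muk nuk]; split.
  by apply: le_lt_trans muk; rewrite lerD2l lerN2.
exact: lt_le_trans nuk e_eps.
Qed.
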